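(* Let $f$ be a slice function on an axially symmetric set $\Omega$ in $\mathbb O$. Let $q\in\Omega$ and let $q=\mathbb I x^T$ with $\mathbb I=(1,I,J,K)\in\mathcal N$ and $x\in\mathbb R^4$. Then for any $p:=\mathbb I' x^T$ with $\mathbb I'=(1,I',J',K')\in\mathcal N$ the following formula holds: $$f(p)=\begin{pmatrix}1&I'&J'&K'\end{pmatrix}\left(\frac14\begin{pmatrix}1&1&1&1\\ -I&-I&I&I\\ -J&J&-J&J\\ -K&K&K&-K\end{pmatrix}\begin{pmatrix} f(q)\\ f(\alpha(q))\\ f(\beta(q))\\ f(\gamma(q))\end{pmatrix}\right).$$
   Context: $\mathbb O$ is the algebra of octonions with its standard inner product on $\mathbb O\cong\mathbb R^8$; $\mathbb S^6=\{x\in\mathbb O: x^2=-1\}$. $\mathcal N$ is the set of row vectors $\mathbb I=(1,I,J,K)\in\mathbb O^4$ with $I,J\in\mathbb S^6$, $I\perp J$, $K=IJ$. For a row vector $y=(y_0,y_1,y_2,y_3)\in\mathbb O^4$ (in particular in $\mathbb R^4$), $\mathbb I y^T=y_0+Iy_1+Jy_2+Ky_3$. $O(3)$ denotes the subgroup of $O(4)$ of matrices $\begin{pmatrix}1&0\\ 0&P\end{pmatrix}$ with $P$ orthogonal $3\times3$, acting on $\mathbb R^4$ and on $\mathbb O^4$ by matrix multiplication. For an open set $[\Omega]\subseteq\mathbb R^4$, the axially symmetric open set generated by $[\Omega]$ is $\Omega=\{\mathbb I x^T:\mathbb I\in\mathcal N,\ x\in[\Omega]\}\subseteq\mathbb O$;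 ''axially symmetric set'' means a set of this form. A function $F:[\Omega]\to\mathbb O^4$ is an $\mathbb O$-stem function if $F(x)=g^{-1}F(gx)$ for all $x\in[\Omega]$, $g\in O(3)$ with $gx\in[\Omega]$. A function $f:\Omega\to\mathbb O$ is a (left) slice function if there is an $\mathbb O$-stem function $F$ on $[\Omega]$ with $f(\mathbb I x^T)=\mathbb I F(x)^T$ for all $\mathbb I\in\mathcal N$, $x\in[\Omega]$ (this is well defined). On $\mathbb R^4$: $\alpha(x)=(x_0,x_1,-x_2,-x_3)$, $\beta(x)=(x_0,-x_1,x_2,-x_3)$, $\gamma(x)=(x_0,-x_1,-x_2,x_3)$. For $q=\mathbb I x^T$, with respect to the fixed $\mathbb I$, $\alpha(q)=\mathbb I\alpha(x)^T$, $\beta(q)=\mathbb I\beta(x)^T$, $\gamma(q)=\mathbb I\gamma(x)^T$. Matrix products are performed in the order indicated by the parentheses (octonions are not associative). *)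

(* Defs.v *)
From mathcomp Require Import all_boot all_order all_algebra.
From mathcomp Require Import all_classical all_reals all_analysis.

Set Implicit Arguments.
Unset Strict Implicit.
Unset Printing Implicit Defensive.

Import Order.TTheory GRing.Theory Num.Theory.
Import numFieldNormedType.Exports.

Local Open Scope classical_set_scope.
Local Open Scope ring_scope.

Definition row4 (V : zmodType) (a b c d : V) : 'rV[V]_4 :=
  \row_(j < 4) [:: a; b; c; d]`_j.

Definition mx4 (V : zmodType) (s : seq (seq V)) : 'M[V]_4 :=
  \matrix_(i < 4, j < 4) (nth [::] s i)`_j.

(* Quaternions in the basis 1, i, j, k; they only serve the Cayley-Dickson
   construction of the octonion product. *)
Definition qmul (R : realType) (a b : 'rV[R]_4) : 'rV[R]_4 :=
  let a0 := a 0 (inord 0) in let a1 := a 0 (inord 1) in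
  let a2 := a 0 (inord 2) in let a3 := a 0 (inord 3) in
  let b0 := b 0 (inord 0) in let b1 := b 0 (inord 1) in
  let b2 := b 0 (inord 2) in let b3 := b 0 (inord 3) in
  row4 (a0 * b0 - a1 * b1 - a2 * b2 - a3 * b3)
       (a0 * b1 + a1 * b0 + a2 * b3 - a3 * b2)
       (a0 * b2 - a1 * b3 + a2 * b0 + a3 * b1)
       (a0 * b3 + a1 * b2 - a2 * b1 + a3 * b0).

Definition qconj (R : realType) (a : 'rV[R]_4) : 'rV[R]_4 :=
  row4 (a 0 (inord 0)) (- a 0 (inord 1)) (- a 0 (inord 2)) (- a 0 (inord 3)).

(* The octonion a + b l, with a and b quaternions, is row_mx a b. *)
Definition octonion (R : realType) := 'rV[R]_(4 + 4).

(* Cayley-Dickson: (a + b l)(c + d l) = (a c - d^* b) + (d a + b c^* ) l. *)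
Definition omul (R : realType) (x y : octonion R) : octonion R :=
  let a := lsubmx x in let b := rsubmx x in
  let c := lsubmx y in let d := rsubmx y in
  row_mx (qmul a c - qmul (qconj d) b) (qmul d a + qmul b (qconj c)).

Definition oone (R : realType) : octonion R := row_mx (row4 1 0 0 0) 0.

Definition oreal (R : realType) (r : R) : octonion R := r *: oone R.

Definition odot (R : realType) (x y : octonion R) : R :=
  \sum_(i < 4 + 4) x 0 i * y 0 i.

(* Octonions are not a pzSemiRingType (no associativity), so mulmx does not
   apply to matrices with octonion entries. *)
Definition omulmx (R : realType) (m n p : nat)
    (A : 'M[octonion R]_(m, n)) (B : 'M[octonion R]_(n, p)) :
    'M[octonion R]_(m, p) :=
  \matrix_(i, k) \sum_j omul (A i j) (B j k).

Definition oscalemx (R : realType) (m n : nat) (r : R)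
    (A : 'M[octonion R]_(m, n)) : 'M[octonion R]_(m, n) :=
  map_mx (fun z => r *: z) A.

Definition S6 (R : realType) : set (octonion R) :=
  [set x | omul x x = - oone R].

Definition frames (R : realType) : set 'rV[octonion R]_4 :=
  [set II | exists I J : octonion R,
     [/\ S6 I, S6 J, odot I J = 0 & II = row4 (oone R) I J (omul I J)]].

(* II y^T *)
Definition frame_eval (R : realType) (II y : 'rV[octonion R]_4) : octonion R :=
  omulmx II y^T 0 0.

(* II x^T, for x in R^4 seen in O^4 *)
Definition frame_pt (R : realType) (II : 'rV[octonion R]_4) (x : 'rV[R]_4) :
    octonion R :=
  frame_eval II (map_mx (@oreal R) x).

Definition O3 (R : realType) : set 'M[R]_(1 + 3) :=
  [set g | exists P : 'M[R]_3,
     P *m P^T = 1%:M /\ g = block_mx 1%:M 0 0 P].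

(* Matrices act on vectors written as rows: g x stands for (g x^T)^T. *)
Definition ract (R : realType) (g : 'M[R]_4) (x : 'rV[R]_4) : 'rV[R]_4 :=
  (g *m x^T)^T.

Definition oact (R : realType) (g : 'M[R]_4) (y : 'rV[octonion R]_4) :
    'rV[octonion R]_4 :=
  \row_i \sum_j g i j *: y 0 j.

Definition axial (R : realType) (D : set 'rV[R]_4) : set (octonion R) :=
  [set q | exists II x, [/\ frames II, D x & q = frame_pt II x]].

(* Functions on D (resp. on axial D) are total functions whose values are only
   constrained on D (resp. on axial D). *)
Definition is_stem (R : realType) (D : set 'rV[R]_4)
    (F : 'rV[R]_4 -> 'rV[octonion R]_4) : Prop :=
  forall (x : 'rV[R]_4) (g : 'M[R]_4), D x -> @O3 R g -> D (ract g x) ->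
    F x = oact (invmx g) (F (ract g x)).

Definition is_slice (R : realType) (D : set 'rV[R]_4)
    (f : octonion R -> octonion R) : Prop :=
  exists F : 'rV[R]_4 -> 'rV[octonion R]_4, is_stem D F /\
    forall II x, frames II -> D x ->
      f (frame_pt II x) = frame_eval II (F x).

Definition alpha (R : realType) (x : 'rV[R]_4) : 'rV[R]_4 :=
  row4 (x 0 (inord 0)) (x 0 (inord 1)) (- x 0 (inord 2)) (- x 0 (inord 3)).

Definition beta (R : realType) (x : 'rV[R]_4) : 'rV[R]_4 :=
  row4 (x 0 (inord 0)) (- x 0 (inord 1)) (x 0 (inord 2)) (- x 0 (inord 3)).

Definition gamma (R : realType) (x : 'rV[R]_4) : 'rV[R]_4 :=
  row4 (x 0 (inord 0)) (- x 0 (inord 1)) (- x 0 (inord 2)) (x 0 (inord 3)).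

(* Main.v *)
(* The representation q = II x^T does not force x into D, only some
   q = II0 x0^T with x0 in D. Then x and x0 have the same real part and the same
   length of imaginary part, so a half-turn P (a rotation, hence mapping frames
   to frames) carries x0 to x. Therefore II x^T = (II P) x0^T for every frame,
   and f (II x^T) = II y^T for all frames II with y = P F(x0) fixed. Evaluating
   at the frames (1, I, J, K), (1, I, -J, -K), (1, -I, J, -K), (1, -I, -J, K)
   gives four signed sums of y0, I y1, J y2, K y3; they are solved for y using
   left alternativity, I (I y1) = - y1. *)

Require Import Defs.
From mathcomp Require Import all_boot all_order all_algebra.
From mathcomp Require Import all_classical all_reals all_analysis.
From mathcomp Require Import ring lra.

Set Implicit Arguments.
Unset Strict Implicit.
Unset Printing Implicit Defensive.

Import Order.TTheory GRing.Theory Num.Theory.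
Import numFieldNormedType.Exports.

Local Open Scope classical_set_scope.
Local Open Scope ring_scope.

(** * Rows of length four *)

Lemma sum_ord4 (V : nmodType) (F : 'I_4 -> V) :
  \sum_j F j = F (inord 0) + F (inord 1) + F (inord 2) + F (inord 3).
Proof.
rewrite !big_ord_recl big_ord0 addr0 !addrA.
by congr (F _ + F _ + F _ + F _); apply: val_inj; rewrite /= inordK.
Qed.

Lemma row4E (V : zmodType) (a b c d : V) :
  (row4 a b c d 0 (inord 0) = a) * (row4 a b c d 0 (inord 1) = b) *
  (row4 a b c d 0 (inord 2) = c) * (row4 a b c d 0 (inord 3) = d).
Proof. by rewrite !mxE !inordK. Qed.

Lemma row4P (V : zmodType) (u v : 'rV[V]_4) :
  [/\ u 0 (inord 0) = v 0 (inord 0), u 0 (inord 1) = v 0 (inord 1),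
      u 0 (inord 2) = v 0 (inord 2) & u 0 (inord 3) = v 0 (inord 3)] -> u = v.
Proof.
case=> e0 e1 e2 e3; apply/rowP => -[[|[|[|[|//]]]] lti].
- by rewrite (_ : Ordinal lti = inord 0) //; apply: val_inj; rewrite /= inordK.
- by rewrite (_ : Ordinal lti = inord 1) //; apply: val_inj; rewrite /= inordK.
- by rewrite (_ : Ordinal lti = inord 2) //; apply: val_inj; rewrite /= inordK.
- by rewrite (_ : Ordinal lti = inord 3) //; apply: val_inj; rewrite /= inordK.
Qed.

Lemma row4_eta (V : zmodType) (u : 'rV[V]_4) :
  u = row4 (u 0 (inord 0)) (u 0 (inord 1)) (u 0 (inord 2)) (u 0 (inord 3)).
Proof. by apply: row4P; rewrite !row4E. Qed.

Lemma row4_inj (V : zmodType) (a b c d a' b' c' d' : V) :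
  row4 a b c d = row4 a' b' c' d' -> [/\ a = a', b = b', c = c' & d = d'].
Proof.
move=> e; have E j : row4 a b c d 0 j = row4 a' b' c' d' 0 j by rewrite e.
by move: (E (inord 0)) (E (inord 1)) (E (inord 2)) (E (inord 3)); rewrite !row4E.
Qed.

(** * Octonion arithmetic in eight real coordinates *)

Section OctonionAlgebra.
Variable R : realType.
Implicit Types (x y z I J K : octonion R) (a b c d r : R).

Definition oct8 (a0 a1 a2 a3 a4 a5 a6 a7 : R) : octonion R :=
  row_mx (row4 a0 a1 a2 a3) (row4 a4 a5 a6 a7).

(** As an elimination rule this exposes the coordinates of an octonion, so that an identity splits
    into eight polynomial identities over [R], each closed by [ring]. *)
Lemma oct8_ind (P : octonion R -> Prop) :
  (forall a0 a1 a2 a3 a4 a5 a6 a7, P (oct8 a0 a1 a2 a3 a4 a5 a6 a7)) ->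
  forall x, P x.
Proof.
move=> Poct x; rewrite -[x]hsubmxK (row4_eta (lsubmx x)) (row4_eta (rsubmx x)).
exact: Poct.
Qed.

Lemma oct8_inj a0 a1 a2 a3 a4 a5 a6 a7 b0 b1 b2 b3 b4 b5 b6 b7 :
  oct8 a0 a1 a2 a3 a4 a5 a6 a7 = oct8 b0 b1 b2 b3 b4 b5 b6 b7 ->
  [/\ a0 = b0, a1 = b1, a2 = b2 & a3 = b3] /\
  [/\ a4 = b4, a5 = b5, a6 = b6 & a7 = b7].
Proof. by move/eq_row_mx => [/row4_inj ? /row4_inj ?]. Qed.

Lemma oct8_add a0 a1 a2 a3 a4 a5 a6 a7 b0 b1 b2 b3 b4 b5 b6 b7 :
  oct8 a0 a1 a2 a3 a4 a5 a6 a7 + oct8 b0 b1 b2 b3 b4 b5 b6 b7 =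
  oct8 (a0 + b0) (a1 + b1) (a2 + b2) (a3 + b3)
       (a4 + b4) (a5 + b5) (a6 + b6) (a7 + b7).
Proof.
rewrite /oct8 add_row_mx; congr row_mx; apply: row4P;
  by rewrite !(row4E, mxE).
Qed.

Lemma oct8_scale r a0 a1 a2 a3 a4 a5 a6 a7 :
  r *: oct8 a0 a1 a2 a3 a4 a5 a6 a7 =
  oct8 (r * a0) (r * a1) (r * a2) (r * a3)
       (r * a4) (r * a5) (r * a6) (r * a7).
Proof.
rewrite /oct8 scale_row_mx; congr row_mx; apply: row4P;
  by rewrite !(row4E, mxE).
Qed.

Lemma oone_oct8 : oone R = oct8 1 0 0 0 0 0 0 0.
Proof.
by rewrite /oone /oct8; congr row_mx; apply: row4P; rewrite !row4E !mxE.
Qed.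

Lemma odot_oct8 a0 a1 a2 a3 a4 a5 a6 a7 b0 b1 b2 b3 b4 b5 b6 b7 :
  odot (oct8 a0 a1 a2 a3 a4 a5 a6 a7) (oct8 b0 b1 b2 b3 b4 b5 b6 b7) =
  a0 * b0 + a1 * b1 + a2 * b2 + a3 * b3 +
  a4 * b4 + a5 * b5 + a6 * b6 + a7 * b7.
Proof.
rewrite /odot big_split_ord !sum_ord4 /oct8 !row_mxEl !row_mxEr !row4E /=.
by rewrite !addrA.
Qed.

Lemma omul_oct8 a0 a1 a2 a3 a4 a5 a6 a7 b0 b1 b2 b3 b4 b5 b6 b7 :
  omul (oct8 a0 a1 a2 a3 a4 a5 a6 a7) (oct8 b0 b1 b2 b3 b4 b5 b6 b7) =
  oct8 (a0 * b0 - a1 * b1 - a2 * b2 - a3 * b3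
          - a4 * b4 - a5 * b5 - a6 * b6 - a7 * b7)
       (a0 * b1 + a1 * b0 + a2 * b3 - a3 * b2
          + a4 * b5 - a5 * b4 - a6 * b7 + a7 * b6)
       (a0 * b2 - a1 * b3 + a2 * b0 + a3 * b1
          + a4 * b6 + a5 * b7 - a6 * b4 - a7 * b5)
       (a0 * b3 + a1 * b2 - a2 * b1 + a3 * b0
          + a4 * b7 - a5 * b6 + a6 * b5 - a7 * b4)
       (a0 * b4 - a1 * b5 - a2 * b6 - a3 * b7
          + a4 * b0 + a5 * b1 + a6 * b2 + a7 * b3)
       (a0 * b5 + a1 * b4 - a2 * b7 + a3 * b6
          - a4 * b1 + a5 * b0 - a6 * b3 + a7 * b2)
       (a0 * b6 + a1 * b7 + a2 * b4 - a3 * b5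
          - a4 * b2 + a5 * b3 + a6 * b0 - a7 * b1)
       (a0 * b7 - a1 * b6 + a2 * b5 + a3 * b4
          - a4 * b3 - a5 * b2 + a6 * b1 + a7 * b0).
Proof.
rewrite /omul /oct8 !row_mxKl !row_mxKr.
have addE (u v : 'rV[R]_4) j : (u + v) 0 j = u 0 j + v 0 j by rewrite mxE.
have oppE (u : 'rV[R]_4) j : (- u) 0 j = - u 0 j by rewrite mxE.
rewrite /qmul /qconj !row4E; congr row_mx; apply: row4P;
  rewrite !(addE, oppE, row4E); split; ring.
Qed.

Lemma oppo_scale x : - x = (-1) *: x. Proof. by rewrite scaleN1r. Qed.

Definition oct8E :=
  (oone_oct8, oppo_scale, oct8_add, oct8_scale, omul_oct8, odot_oct8).

Lemma omul1l x : omul (oone R) x = x.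
Proof.
by elim/oct8_ind: x => *; rewrite !oct8E; congr oct8; ring.
Qed.

Lemma omul1r x : omul x (oone R) = x.
Proof.
by elim/oct8_ind: x => *; rewrite !oct8E; congr oct8; ring.
Qed.

Lemma omulDl x y z : omul (x + y) z = omul x z + omul y z.
Proof.
by elim/oct8_ind: x => *; elim/oct8_ind: y => *; elim/oct8_ind: z => *;
  rewrite !oct8E; congr oct8; ring.
Qed.

Lemma omulDr x y z : omul x (y + z) = omul x y + omul x z.
Proof.
by elim/oct8_ind: x => *; elim/oct8_ind: y => *; elim/oct8_ind: z => *;
  rewrite !oct8E; congr oct8; ring.
Qed.

Lemma omulZl r x y : omul (r *: x) y = r *: omul x y.
Proof.
by elim/oct8_ind: x => *; elim/oct8_ind: y => *;
  rewrite !oct8E; congr oct8; ring.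
Qed.

Lemma omulZr r x y : omul x (r *: y) = r *: omul x y.
Proof.
by elim/oct8_ind: x => *; elim/oct8_ind: y => *;
  rewrite !oct8E; congr oct8; ring.
Qed.

Lemma omulNl x y : omul (- x) y = - omul x y.
Proof. by rewrite oppo_scale omulZl -oppo_scale. Qed.

Lemma omulNr x y : omul x (- y) = - omul x y.
Proof. by rewrite oppo_scale omulZr -oppo_scale. Qed.

Lemma omulAl x y : omul x (omul x y) = omul (omul x x) y.
Proof.
by elim/oct8_ind: x => *; elim/oct8_ind: y => *;
  rewrite !oct8E; congr oct8; ring.
Qed.

Lemma omulAr x y : omul (omul x y) y = omul x (omul y y).
Proof.
by elim/oct8_ind: x => *; elim/oct8_ind: y => *;
  rewrite !oct8E; congr oct8; ring.
Qed.

(** The case [z = y] of the middle Moufang identity [(x y) (z x) = (x (y z)) x]. *)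
Lemma omul_palindrome x y :
  omul (omul x y) (omul y x) = omul (omul x (omul y y)) x.
Proof.
by elim/oct8_ind: x => *; elim/oct8_ind: y => *;
  rewrite !oct8E; congr oct8; ring.
Qed.

(** Polarization of [x^2 = 2 Re(x) x - |x|^2], with [Re(x)] written as [odot x (oone R)]. Orthogonal
    imaginary octonions therefore anticommute. *)
Lemma omul_anticomm x y :
  omul x y + omul y x = 2 * odot x (oone R) *: y + 2 * odot y (oone R) *: x
                        - 2 * odot x y *: oone R.
Proof.
by elim/oct8_ind: x => *; elim/oct8_ind: y => *;
  rewrite !oct8E; congr oct8; ring.
Qed.

(** The imaginary coordinates of [x^2] are [2 a0 ai]. If [a0] were nonzero, every [ai] would vanish
    and [a0^2 = -1] would hold in [R]. *)
Lemma S6_re0 x : S6 x -> odot x (oone R) = 0.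
Proof.
elim/oct8_ind: x => a0 a1 a2 a3 a4 a5 a6 a7; rewrite /S6 /= !oct8E.
move=> /oct8_inj[[e0 e1 e2 e3] [e4 e5 e6 e7]].
have [-> | a0N0] := eqVneq a0 0; first by ring.
have cancel a : a0 * a = 0 -> a = 0.
  by move/eqP; rewrite mulf_eq0 (negPf a0N0) /= => /eqP.
have a1E : a1 = 0 by apply: cancel; lra.
have a2E : a2 = 0 by apply: cancel; lra.
have a3E : a3 = 0 by apply: cancel; lra.
have a4E : a4 = 0 by apply: cancel; lra.
have a5E : a5 = 0 by apply: cancel; lra.
have a6E : a6 = 0 by apply: cancel; lra.
have a7E : a7 = 0 by apply: cancel; lra.
by move: e0; subst; nra.
Qed.

Lemma odotDl x y z : odot (x + y) z = odot x z + odot y z.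
Proof.
by elim/oct8_ind: x => *; elim/oct8_ind: y => *; elim/oct8_ind: z => *;
  rewrite !oct8E; ring.
Qed.

Lemma odotZl r x y : odot (r *: x) y = r * odot x y.
Proof.
by elim/oct8_ind: x => *; elim/oct8_ind: y => *; rewrite !oct8E; ring.
Qed.

Lemma odotC x y : odot x y = odot y x.
Proof. by rewrite /odot; apply: eq_bigr => i _; rewrite mulrC. Qed.

Lemma odotNl x y : odot (- x) y = - odot x y.
Proof. by rewrite oppo_scale odotZl mulN1r. Qed.

Lemma odotNr x y : odot x (- y) = - odot x y.
Proof. by rewrite odotC odotNl odotC. Qed.

Lemma re_omul x y :
  odot (omul x y) (oone R) = 2 * odot x (oone R) * odot y (oone R) - odot x y.
Proof.
by elim/oct8_ind: x => *; elim/oct8_ind: y => *; rewrite !oct8E; ring.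
Qed.

Lemma re_one : odot (oone R) (oone R) = 1.
Proof. by rewrite !oct8E; ring. Qed.

(** * Frames and their rotations *)

Lemma S6N x : S6 x -> S6 (- x).
Proof. by rewrite /S6 /= omulNl omulNr opprK. Qed.

Lemma framesP I J K :
  frames (row4 (oone R) I J K) <->
  [/\ S6 I, S6 J, odot I J = 0 & K = omul I J].
Proof.
split=> [[I0 [J0 [SI SJ IJ0 /row4_inj[_ -> -> ->]]]] // | [SI SJ IJ0 ->]].
by exists I, J.
Qed.

Definition imag_comb I J K a b c : octonion R := a *: I + b *: J + c *: K.

Section Frame.
Variables I J K : octonion R.
Hypothesis frameIJK : frames (row4 (oone R) I J K).

(** A frame multiplies like the quaternion units. Anticommutation gives [J I = - K]; writing [K] as
    [I J] or [- J I] then puts equal factors side by side, where alternativity applies. *)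
Lemma frame_mul_table :
  (omul I I = - oone R) * (omul J J = - oone R) * (omul K K = - oone R) *
  (omul I J = K) * (omul J K = I) * (omul K I = J) *
  (omul J I = - K) * (omul K J = - I) * (omul I K = - J).
Proof.
have [SI SJ IJ0 KE] := (framesP I J K).1 frameIJK.
have JI : omul J I = - K.
  have := omul_anticomm I J.
  rewrite (S6_re0 SI) (S6_re0 SJ) IJ0 mulr0 !scale0r !addr0 subrr -KE.
  by move/eqP; rewrite addrC addr_eq0 => /eqP.
have IK : omul I K = - J by rewrite KE omulAl SI omulNl omul1l.
have KJ : omul K J = - I by rewrite KE omulAr SJ omulNr omul1r.
have JK : omul J K = I.
  by rewrite -[K]opprK -JI omulNr omulAl SJ omulNl omul1l opprK.
have KI : omul K I = J.
  by rewrite -[K]opprK -JI omulNl omulAr SI omulNr omul1r opprK.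
have KK : omul K K = - oone R.
  (* Here [K K = - (I J) (J I)], to which the Moufang identity applies. *)
  rewrite -[X in omul _ X]opprK -JI omulNr KE omul_palindrome SJ.
  by rewrite omulNr omul1r omulNl SI opprK.
by [].
Qed.

(** The rule for imaginary quaternions: minus the dot product plus the cross product. *)
Lemma omul_imag_comb a1 a2 a3 b1 b2 b3 :
  omul (imag_comb I J K a1 a2 a3) (imag_comb I J K b1 b2 b3) =
  - (a1 * b1 + a2 * b2 + a3 * b3) *: oone R +
  imag_comb I J K (a2 * b3 - a3 * b2) (a3 * b1 - a1 * b3) (a1 * b2 - a2 * b1).
Proof.
rewrite /imag_comb !(omulDl, omulDr, omulZl, omulZr) !frame_mul_table.
by move: (oone R) I J K => e i j k; apply/rowP => l; rewrite !mxE; ring.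
Qed.

Lemma re_imag_comb a b c : odot (imag_comb I J K a b c) (oone R) = 0.
Proof.
have [SI SJ _ _] := (framesP I J K).1 frameIJK.
have SK : S6 K by rewrite /S6 /= frame_mul_table.
by rewrite !(odotDl, odotZl) !S6_re0 // !mulr0 !addr0.
Qed.

Lemma re_add_imag_comb r a b c :
  odot (r *: oone R + imag_comb I J K a b c) (oone R) = r.
Proof. by rewrite odotDl odotZl re_one mulr1 re_imag_comb addr0. Qed.

(** Since [c] is the cross product of the orthonormal vectors [a] and [b], the three rows form a
    rotation matrix. *)
Lemma frames_rotate a1 a2 a3 b1 b2 b3 c1 c2 c3 :
  a1 * a1 + a2 * a2 + a3 * a3 = 1 -> b1 * b1 + b2 * b2 + b3 * b3 = 1 ->
  a1 * b1 + a2 * b2 + a3 * b3 = 0 ->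
  [/\ c1 = a2 * b3 - a3 * b2, c2 = a3 * b1 - a1 * b3 & c3 = a1 * b2 - a2 * b1] ->
  frames (row4 (oone R) (imag_comb I J K a1 a2 a3) (imag_comb I J K b1 b2 b3)
            (imag_comb I J K c1 c2 c3)).
Proof.
move=> aa bb ab [-> -> ->].
have comb0 : imag_comb I J K 0 0 0 = 0 by rewrite /imag_comb !scale0r !addr0.
have S6comb d1 d2 d3 : d1 * d1 + d2 * d2 + d3 * d3 = 1 ->
    S6 (imag_comb I J K d1 d2 d3).
  move=> dd; rewrite /S6 /= omul_imag_comb dd scaleN1r.
  have -> : imag_comb I J K (d2 * d3 - d3 * d2) (d3 * d1 - d1 * d3)
                            (d1 * d2 - d2 * d1) = 0.
    by rewrite (mulrC d3 d2) (mulrC d1 d3) (mulrC d2 d1) !subrr.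
  by rewrite addr0.
apply/framesP; split; [exact: S6comb | exact: S6comb | | ].
  (* For imaginary octonions the inner product is minus the real part of the product, here minus the
     dot product of the coefficients. *)
  have := re_omul (imag_comb I J K a1 a2 a3) (imag_comb I J K b1 b2 b3).
  rewrite omul_imag_comb ab oppr0 scale0r add0r !re_imag_comb mulr0 sub0r.
  by move/esym/eqP; rewrite oppr_eq0 => /eqP.
by rewrite omul_imag_comb ab oppr0 scale0r add0r.
Qed.

End Frame.

(** * Points and values expressed in a frame *)

Lemma frame_evalE (a b c d : octonion R) (y : 'rV[octonion R]_4) :
  frame_eval (row4 a b c d) y =
  omul a (y 0 (inord 0)) + omul b (y 0 (inord 1)) +
  omul c (y 0 (inord 2)) + omul d (y 0 (inord 3)).
Proof. by rewrite /frame_eval mxE sum_ord4 !row4E ![y^T _ _]mxE. Qed.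

Lemma frame_ptE I J K (v : 'rV[R]_4) :
  frame_pt (row4 (oone R) I J K) v =
  v 0 (inord 0) *: oone R +
  imag_comb I J K (v 0 (inord 1)) (v 0 (inord 2)) (v 0 (inord 3)).
Proof.
by rewrite /frame_pt frame_evalE !mxE /oreal !omulZr !omul1r !addrA.
Qed.

Lemma frame_pt_eq_norm I J K I0 J0 K0 (v v0 : 'rV[R]_4) :
  frames (row4 (oone R) I J K) -> frames (row4 (oone R) I0 J0 K0) ->
  frame_pt (row4 (oone R) I J K) v = frame_pt (row4 (oone R) I0 J0 K0) v0 ->
  v 0 (inord 0) = v0 0 (inord 0) /\
  v 0 (inord 1) ^+ 2 + v 0 (inord 2) ^+ 2 + v 0 (inord 3) ^+ 2 =
  v0 0 (inord 1) ^+ 2 + v0 0 (inord 2) ^+ 2 + v0 0 (inord 3) ^+ 2.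
Proof.
move=> NII NII0; rewrite !frame_ptE => e.
have v0E : v 0 (inord 0) = v0 0 (inord 0).
  have := congr1 (fun z => odot z (oone R)) e.
  by rewrite !re_add_imag_comb.
split=> //; move: e; rewrite v0E => /addrI e.
(* The square of an imaginary octonion has real part minus its squared length, which does not depend
   on the frame. *)
have := congr1 (fun z => odot (omul z z) (oone R)) e.
by rewrite !omul_imag_comb // !re_add_imag_comb // !expr2 => /oppr_inj.
Qed.

(** Left multiplication by [- I / 4] recovers [x], because [I (I x) = - x] by left alternativity.
    This inverts the rows of the matrix that belong to [I], [J] and [K]. *)
Lemma S6_quarter_sum I x (a b c d : octonion R) :
  S6 I -> a + b - c - d = 4 *: omul I x ->
  omul (4^-1 *: - I) a + omul (4^-1 *: - I) b +
  omul (4^-1 *: I) c + omul (4^-1 *: I) d = x.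
Proof.
move=> SI /(congr1 (fun z => - (4^-1 *: omul I z))) /=.
rewrite omulZr omulAl SI omulNl omul1l scalerA mulVf ?pnatr_eq0 // scale1r opprK.
move=> <-; rewrite !omulDr !omulNr !omulZl !omulNl.
move: (omul I a) (omul I b) (omul I c) (omul I d) => {}a {}b {}c {}d.
by apply/rowP => l; rewrite !mxE; ring.
Qed.

(* The axis is v + w, or any vector orthogonal to v when w = - v. *)
Lemma half_turn_axis (v1 v2 v3 w1 w2 w3 : R) :
  v1 ^+ 2 + v2 ^+ 2 + v3 ^+ 2 = w1 ^+ 2 + w2 ^+ 2 + w3 ^+ 2 ->
  exists u1 u2 u3 : R, u1 ^+ 2 + u2 ^+ 2 + u3 ^+ 2 != 0 /\
  let c := 2 * (u1 * v1 + u2 * v2 + u3 * v3) / (u1 ^+ 2 + u2 ^+ 2 + u3 ^+ 2) in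
  [/\ w1 = c * u1 - v1, w2 = c * u2 - v2 & w3 = c * u3 - v3].
Proof.
move=> vw.
have sq3_eq0 (a b c : R) : a ^+ 2 + b ^+ 2 + c ^+ 2 = 0 ->
    [/\ a = 0, b = 0 & c = 0].
  move=> /eqP; rewrite paddr_eq0 ?addr_ge0 ?sqr_ge0 //.
  rewrite paddr_eq0 ?sqr_ge0 // !sqrf_eq0.
  by move=> /andP[/andP[/eqP-> /eqP->] /eqP->].
have [w0 | wN0] :=
    eqVneq ((v1 + w1) ^+ 2 + (v2 + w2) ^+ 2 + (v3 + w3) ^+ 2) 0; last first.
  exists (v1 + w1), (v2 + w2), (v3 + w3); split=> //=.
  (* As [|v| = |w|], for [u = v + w] one has [2 <u, v> = |u|^2], so the factor [c] equals 1. *)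
  rewrite [2 * _](_ : _ = (v1 + w1) ^+ 2 + (v2 + w2) ^+ 2 + (v3 + w3) ^+ 2).
    by rewrite divff // !mul1r; split; ring.
  by lra.
have [/eqP e1 /eqP e2 /eqP e3] := sq3_eq0 _ _ _ w0.
move: e1 e2 e3; rewrite ![v1 + _]addrC ![v2 + _]addrC ![v3 + _]addrC !addr_eq0.
move=> /eqP-> /eqP-> /eqP->.
(* Now [w = - v], so any nonzero [u] orthogonal to [v] gives [c = 0]. The choice [(- v2, v1, 0)]
   fails only if [v1 = v2 = 0], and then the first basis vector serves. *)
have [v120 | v12N0] := eqVneq (v1 ^+ 2 + v2 ^+ 2) 0.
  have [-> -> _] : [/\ v1 = 0, v2 = 0 & 0 = 0 :> R].
    by apply: sq3_eq0; rewrite v120 expr0n addr0.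
  exists 1, 0, 0; split; first by rewrite expr0n expr1n !addr0 oner_neq0.
  by rewrite /= !mulr0 !mul0r !addr0 mulr0 !mul0r !sub0r.
exists (- v2), v1, 0; split; first by rewrite expr0n addr0 sqrrN addrC.
by rewrite /= (_ : 2 * _ = 0) ?mul0r ?sub0r //; ring.
Qed.

Lemma slice_frame_linear (D : set 'rV[R]_4) (f : octonion R -> octonion R)
    (I J K : octonion R) (x : 'rV[R]_4) :
  is_slice D f -> frames (row4 (oone R) I J K) ->
  axial D (frame_pt (row4 (oone R) I J K) x) ->
  exists y : 'rV[octonion R]_4, forall I' J' K', frames (row4 (oone R) I' J' K') ->
    f (frame_pt (row4 (oone R) I' J' K') x) =
    frame_eval (row4 (oone R) I' J' K') y.
Proof.
move=> [F [_ fF]] NII [_ [x0 [[I0 [J0 [SI0 SJ0 IJ0 ->]]] Dx0 qE]]].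
have NII0 : frames (row4 (oone R) I0 J0 (omul I0 J0)) by exact/framesP.
have [x00 /esym xx] := frame_pt_eq_norm NII NII0 qE.
have [u1 [u2 [u3 [uN0 /= [x1E x2E x3E]]]]] := half_turn_axis xx.
set n := u1 ^+ 2 + u2 ^+ 2 + u3 ^+ 2 in uN0 x1E x2E x3E.
pose y := F x0.
pose y1 := y 0 (inord 1); pose y2 := y 0 (inord 2); pose y3 := y 0 (inord 3).
(* The half-turn 2 u u^T / |u|^2 - 1 about u is symmetric, so the same entries
   act on the frame and on y. *)
pose c i j := 2 * i * j / n.
exists (row4 (y 0 (inord 0))
  (imag_comb y1 y2 y3 (c u1 u1 - 1) (c u1 u2) (c u1 u3))
  (imag_comb y1 y2 y3 (c u2 u1) (c u2 u2 - 1) (c u2 u3))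
  (imag_comb y1 y2 y3 (c u3 u1) (c u3 u2) (c u3 u3 - 1))).
move=> I' J' K' NII'.
have NII'' : frames (row4 (oone R)
    (imag_comb I' J' K' (c u1 u1 - 1) (c u1 u2) (c u1 u3))
    (imag_comb I' J' K' (c u2 u1) (c u2 u2 - 1) (c u2 u3))
    (imag_comb I' J' K' (c u3 u1) (c u3 u2) (c u3 u3 - 1))).
  (* The first two rows of the half-turn matrix are orthonormal, and the third is their cross
     product. *)
  by apply: frames_rotate => //; [ | | |split]; rewrite /c /n; field.
rewrite [frame_pt _ _](_ : _ = frame_pt (row4 (oone R)
    (imag_comb I' J' K' (c u1 u1 - 1) (c u1 u2) (c u1 u3))
    (imag_comb I' J' K' (c u2 u1) (c u2 u2 - 1) (c u2 u3))
    (imag_comb I' J' K' (c u3 u1) (c u3 u2) (c u3 u3 - 1))) x0); last first.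
  rewrite !frame_ptE x00 x1E x2E x3E /imag_comb; congr (_ + _).
  by move: I' J' K' {NII' NII''} => i j k; apply/rowP => l; rewrite !mxE /c; ring.
rewrite fF // !frame_evalE !row4E -/y -/y1 -/y2 -/y3 /imag_comb.
(* Both sides become real combinations of the same products; once these are generalized, the
   identity is linear and can be checked coordinatewise. *)
rewrite !(omulDl, omulDr, omulZl, omulZr).
move: (omul _ _) (omul I' y1) (omul I' y2) (omul I' y3) (omul J' y1)
  (omul J' y2) (omul J' y3) (omul K' y1) (omul K' y2) (omul K' y3).
move=> z0 z1 z2 z3 z4 z5 z6 z7 z8 z9.
by apply/rowP => l; rewrite !mxE /c; ring.
Qed.

End OctonionAlgebra.

Theorem theorem3p9 (R : realType) (D : set 'rV[R]_4) (openD : open D)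
    (f : octonion R -> octonion R) (slice_f : is_slice D f)
    (q : octonion R) (Oq : axial D q)
    (I J K : octonion R) (x : 'rV[R]_4)
    (NII : frames (row4 (oone R) I J K))
    (q_def : q = frame_pt (row4 (oone R) I J K) x)
    (I' J' K' : octonion R) (NII' : frames (row4 (oone R) I' J' K'))
    (p : octonion R) (p_def : p = frame_pt (row4 (oone R) I' J' K') x) :
  let II := row4 (oone R) I J K in
  let one := oone R in
  f p = omulmx (row4 one I' J' K')
    (omulmx
      (oscalemx 4^-1
        (mx4 [:: [:: one; one; one; one];
                 [:: - I; - I; I; I];
                 [:: - J; J; - J; J];
                 [:: - K; K; K; - K]]))
      (row4 (f q) (f (frame_pt II (alpha x))) (f (frame_pt II (beta x)))
        (f (frame_pt II (gamma x))))^T) 0 0.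

Proof.
move=> II one.
have [SI SJ IJ0 KE] := (framesP I J K).1 NII.
have [y fy] : exists y : 'rV[octonion R]_4, forall I0 J0 K0, frames (row4 (oone R) I0 J0 K0) ->
    f (frame_pt (row4 (oone R) I0 J0 K0) x) =
    frame_eval (row4 (oone R) I0 J0 K0) y.
  by apply: slice_frame_linear slice_f NII _; rewrite -q_def.
pose y0 := y 0 (inord 0); pose y1 := omul I (y 0 (inord 1)).
pose y2 := omul J (y 0 (inord 2)); pose y3 := omul K (y 0 (inord 3)).
have fq : f q = y0 + y1 + y2 + y3.
  by rewrite q_def fy // frame_evalE omul1l.
(* The signs pass from [x] to the frame: [alpha x] in [(1, I, J, K)] is the same point as [x] in the
   frame [(1, I, - J, - K)]. Likewise for [beta] and [gamma]. *)
have fa : f (frame_pt II (alpha x)) = y0 + y1 - y2 - y3.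
  rewrite -!omulNl -[y0]omul1l -frame_evalE -fy; last first.
    by apply/framesP; split;
      rewrite ?odotNr ?IJ0 ?oppr0 ?omulNr ?KE //; apply: S6N.
  by rewrite !frame_ptE /alpha !row4E /imag_comb !scaleNr !scalerN.
have fb : f (frame_pt II (beta x)) = y0 - y1 + y2 - y3.
  rewrite -!omulNl -[y0]omul1l -frame_evalE -fy; last first.
    by apply/framesP; split;
      rewrite ?odotNl ?IJ0 ?oppr0 ?omulNl ?KE //; apply: S6N.
  by rewrite !frame_ptE /beta !row4E /imag_comb !scaleNr !scalerN.
have fc : f (frame_pt II (gamma x)) = y0 - y1 - y2 + y3.
  rewrite -!omulNl -[y0]omul1l -frame_evalE -fy; last first.
    by apply/framesP; split;
      rewrite ?odotNl ?odotNr ?IJ0 ?oppr0 ?omulNl ?omulNr ?KE ?opprK //; apply: S6N.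
  by rewrite !frame_ptE /gamma !row4E /imag_comb !scaleNr !scalerN.
rewrite p_def fy // /frame_eval; congr (omulmx _ _ 0 0).
apply: trmx_inj; rewrite trmxK.
have SK : S6 K by rewrite /S6 /= (frame_mul_table NII).
apply: row4P; rewrite !mxE !sum_ord4 !mxE !inordK //= fq fa fb fc.
split; apply/esym.
(* In the sum of the four values everything but [4 y0] cancels. *)
- rewrite !omulZl !omul1l -/y0; move: (y0) (y1) (y2) (y3) => z0 z1 z2 z3.
  by apply/rowP => l; rewrite !mxE; field.
- apply: S6_quarter_sum SI _; rewrite -/y1; move: (y0) (y1) (y2) (y3) => z0 z1 z2 z3.
  by apply/rowP => l; rewrite !mxE; ring.
(* [S6_quarter_sum] expects the two terms with [- J] first, so the terms at [alpha x] and [beta x]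
   are swapped. *)
- rewrite [X in X + _]addrAC.
  apply: S6_quarter_sum SJ _; rewrite -/y2; move: (y0) (y1) (y2) (y3) => z0 z1 z2 z3.
  by apply/rowP => l; rewrite !mxE; ring.
(* The term at [gamma x] moves to second place, next to the other term with [- K]. *)
- rewrite addrAC [X in X + _]addrAC.
  apply: S6_quarter_sum SK _; rewrite -/y3; move: (y0) (y1) (y2) (y3) => z0 z1 z2 z3.
  by apply/rowP => l; rewrite !mxE; ring.
Qed.
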